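(* Let $\mathcal C\subseteq\mathcal U^{|z|}$ be saturated and assume that $o(\mathcal C/A)$ has finite VC-dimension for some small $A\subseteq\mathcal U$. Then $\mathcal C$ is approximable from below and approximable from above.
   Context: $\mathcal U$ is a saturated model of a first-order signature $L$, of uncountable inaccessible cardinality $\kappa>|L|$; small means of cardinality $<\kappa$; $z$ is a finite tuple of variables. $\mathcal C$ is saturated if the expansion $\langle\mathcal U,\mathcal C\rangle$ of $\mathcal U$ by a new predicate for $\mathcal C$ is a saturated model. $o(\mathcal C/A)=\{f[\mathcal C]:f\in\mathrm{Aut}(\mathcal U/A)\}$. A family $u\subseteq\mathcal P(\mathcal U^{|z|})$ shatters $B$ if every $H\subseteq B$ equals $B\cap\mathcal E$ for some $\mathcal E\in u$; finite VC-dimension means some finite size of sets is never shattered. For $\varphi(x,z)\in L$, a tuple $b$ and $B\subseteq\mathcal U$, $\varphi(b,B)=\{c\in B^{|z|}:\models\varphi(b,c)\}$. $\mathcal C$ is approximable from below (resp. from above) if there is $\varphi(x,z)\in L$ such that for every finite $B\subseteq\mathcal U$ there is $b\in\mathcal U^{|x|}$ with $\varphi(b,B)=\mathcal C\cap B^{|z|}$ and $\varphi(b,\mathcal U)\subseteq\mathcal C$ (resp. $\mathcal C\subseteq\varphi(b,\mathcal U)$). *)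

(* Defs.v *)
From mathcomp Require Import all_boot.
From mathcomp Require Import boolp classical_sets functions cardinality.

Set Implicit Arguments.
Unset Strict Implicit.
Unset Printing Implicit Defensive.

Local Open Scope classical_set_scope.
Local Open Scope card_scope.

Definition card_lt (S T : Type) (A : set S) (B : set T) : Prop :=
  (A #<= B) /\ ~ (B #<= A).

Record signature : Type := Signature {
  fun_symb : Type;
  rel_symb : Type;
  fun_arity : fun_symb -> nat;
  rel_arity : rel_symb -> nat
}.

Record structure (L : signature) : Type := Structure {
  carrier :> Type;
  finterp : forall f : fun_symb L, ('I_(fun_arity f) -> carrier) -> carrier;
  rinterp : forall r : rel_symb L, set ('I_(rel_arity r) -> carrier)
}.

Inductive term (L : signature) (V : Type) : Type :=
| TVar of V
| TApp (f : fun_symb L) of ('I_(fun_arity f) -> term L V).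

(* First-order L-formulas with equality whose free variables lie in V.
   [FAll] binds the variable [None] of [option V]. *)
Inductive form (L : signature) (V : Type) : Type :=
| FBot
| FEq of term L V & term L V
| FRel (r : rel_symb L) of ('I_(rel_arity r) -> term L V)
| FImp of form L V & form L V
| FAll of form L (option V).

Section Semantics.
Variables (L : signature) (U : structure L).

Fixpoint eval (V : Type) (e : V -> U) (t : term L V) : U :=
  match t with
  | TVar v => e v
  | TApp f ts => finterp (fun i => eval e (ts i))
  end.

Definition bind (V : Type) (a : U) (e : V -> U) (v : option V) : U :=
  if v is Some w then e w else a.

Fixpoint sat (V : Type) (p : form L V) : (V -> U) -> Prop :=
  match p with
  | FBot => fun=> False
  | FEq t s => fun e => eval e t = eval e s
  | FRel r ts => fun e => rinterp (fun i => eval e (ts i))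
  | FImp q r => fun e => sat q e -> sat r e
  | FAll q => fun e => forall a : U, sat q (bind a e)
  end.

Definition small (A : set U) : Prop := card_lt A [set: U].

(* Formulas in one variable with parameters in A are elements of
   [form L (option A)]: [None] is the variable, [Some a] the parameter a. *)
Definition realizes (A : set U) (a : U) (p : set (form L (option A))) : Prop :=
  forall q, p q -> sat q (bind a (fun c : A => val c)).

(* Saturation in the cardinality of U itself. *)
Definition saturated : Prop :=
  forall (A : set U) (p : set (form L (option A))), small A ->
    (forall q, finite_set q -> q `<=` p -> exists a, realizes a q) ->
    exists a, realizes a p.

Definition automorphism (f : U -> U) : Prop :=
  [/\ bijective f,
      forall (g : fun_symb L) (c : 'I_(fun_arity g) -> U),
        f (finterp c) = finterp (f \o c)
    & forall (r : rel_symb L) (c : 'I_(rel_arity r) -> U),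
        rinterp (f \o c) <-> rinterp c].

Definition automorphism_over (A : set U) (f : U -> U) : Prop :=
  automorphism f /\ forall a, A a -> f a = a.

Definition aut_orbit (m : nat) (C : set ('I_m -> U)) (A : set U) :
    set (set ('I_m -> U)) :=
  [set E | exists2 f, automorphism_over A f & E = (fun c => f \o c) @` C].

Definition tuples (m : nat) (B : set U) : set ('I_m -> U) :=
  [set c | forall i, B (c i)].

Definition pair_env (n m : nat) (b : 'I_n -> U) (c : 'I_m -> U)
    (v : 'I_n + 'I_m) : U :=
  match v with inl i => b i | inr j => c j end.

(* phi(b, B) *)
Definition instance (n m : nat) (phi : form L ('I_n + 'I_m)) (b : 'I_n -> U)
    (B : set U) : set ('I_m -> U) :=
  [set c | tuples B c /\ sat phi (pair_env b c)].

Definition approximable_below (m : nat) (C : set ('I_m -> U)) : Prop :=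
  exists (n : nat) (phi : form L ('I_n + 'I_m)),
    forall B : set U, finite_set B ->
      exists b : 'I_n -> U,
        instance phi b B = C `&` tuples B /\ instance phi b setT `<=` C.

Definition approximable_above (m : nat) (C : set ('I_m -> U)) : Prop :=
  exists (n : nat) (phi : form L ('I_n + 'I_m)),
    forall B : set U, finite_set B ->
      exists b : 'I_n -> U,
        instance phi b B = C `&` tuples B /\ C `<=` instance phi b setT.

End Semantics.

Definition expand_sig (L : signature) (m : nat) : signature :=
  @Signature (fun_symb L) (option (rel_symb L)) (@fun_arity L)
    (fun r => if r is Some s then rel_arity s else m).

Definition expand (L : signature) (U : structure L) (m : nat)
    (C : set ('I_m -> U)) : structure (expand_sig L m) :=
  @Structure (expand_sig L m) U (fun (f : fun_symb L) c => @finterp L U f c)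
    (fun r : option (rel_symb L) =>
       match r return set ('I_(if r is Some s then rel_arity s else m) -> U) with
       | Some s => @rinterp L U s
       | None => C
       end).

Definition saturated_set (L : signature) (U : structure L) (m : nat)
    (C : set ('I_m -> U)) : Prop := saturated (expand C).

Definition shatters (T : Type) (u : set (set T)) (B : set T) : Prop :=
  forall H, H `<=` B -> exists2 E, u E & H = B `&` E.

Definition finite_VC (T : Type) (u : set (set T)) : Prop :=
  exists k : nat, forall B : set T, B #= `I_k -> ~ shatters u B.

Definition strong_limit (K : Type) : Prop :=
  forall A : set K, card_lt A [set: K] ->
    card_lt [set B : set K | B `<=` A] [set: K].

(* Index sets of size < |K| may be taken to be subsets of K. *)
Definition regular (K : Type) : Prop :=
  forall (I : set K) (F : K -> set K), card_lt I [set: K] ->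
    (forall i, I i -> card_lt (F i) [set: K]) ->
    card_lt (\bigcup_(i in I) F i) [set: K].

(* The cardinality of K is an uncountable (strongly) inaccessible cardinal. *)
Definition inaccessible (K : Type) : Prop :=
  [/\ ~ countable [set: K], regular K & strong_limit K].

(* Main.v *)
Require Import Defs.
From mathcomp Require Import all_boot.
From mathcomp Require Import boolp classical_sets functions cardinality filter.
From mathcomp Require wochoice.

Set Implicit Arguments.
Unset Strict Implicit.
Unset Printing Implicit Defensive.

Local Open Scope classical_set_scope.

(* There are fewer formulas than elements of U, so a failure of approximability
   from below is witnessed by one small set B, containing A, on which every
   formula fails. It therefore suffices to find, for small B, a formula theta
   with parameters in U such that C n B^m <= theta(U) <= C. If there is none,
   the sets (C n B^m) \ theta(U), for theta(U) <= C, generate a proper filter;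
   let F be an ultrafilter containing it. As <U, C> is saturated, there are
   tuples b_n realizing the average L-type of F over B, b_0, ..., b_(n-1) with
   b_n in C exactly when n is even: for odd n, an obstruction would be a formula
   in the average type with all its solutions in C. The sequence is
   L-indiscernible over B, and U is homogeneous, so for every set I of indices
   below k some automorphism over A maps b_(2i) to itself for i in I and
   b_(2i+1) to b_(2i) for the other i < k. Hence the orbit of C shatters
   {b_(2i) : i < k} for every k. Approximability from above is approximability
   from below of the complement of C. *)

(** * Cardinalities below an inaccessible one *)

Local Open Scope card_scope.

Lemma card_leT_inj (X Y : Type) (f : X -> Y) (B : set Y) :
  injective f -> range f `<=` B -> [set: X] #<= B.
Proof.
move=> f_inj fB; apply: card_le_trans (subset_card_le fB).
by have /card_esym := inj_card_eq (in2W f_inj : {in [set: X] &, injective f});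
   rewrite card_eq_le => /andP[].
Qed.

Lemma inj_card_leT (X Y : Type) (B : set Y) :
  [set: X] #<= B -> exists f : X -> Y, injective f /\ range f `<=` B.
Proof.
move=> /card_leP[/= f].
pose g (x : X) := val (f (SigSub (mem_set (I : [set: X] x)))).
exists g; split=> [x y /val_inj E|_ [x _ <-]]; last exact: set_mem (valP _).
have : SigSub (mem_set (I : [set: X] x)) = SigSub (mem_set (I : [set: X] y)).
  by apply: (@inj _ _ _ f); rewrite ?inE.
by move=> /(congr1 val).
Qed.

Lemma card_le_lt (K S T : Type) (A : set S) (B : set T) :
  A #<= B -> card_lt B [set: K] -> card_lt A [set: K].
Proof.
move=> AB [BK KB]; split; first exact: card_le_trans BK.
by move=> KA; apply: KB; apply: card_le_trans AB.
Qed.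

Section Inaccessible.
Variables (K : Type) (K_inacc : inaccessible K).

Lemma inaccessible_infinite : [set: nat] #<= [set: K].
Proof.
by case: K_inacc => K_unc _ _; apply/infiniteP => /finite_set_countable.
Qed.

Lemma inaccessible_nonempty : [set: K] !=set0.
Proof. by have [f _] := inj_card_leT inaccessible_infinite; exists (f 0). Qed.

Lemma countable_card_lt (T : Type) (A : set T) :
  countable A -> card_lt A [set: K].
Proof.
move=> A_count; apply: (card_le_lt A_count); split.
  exact: inaccessible_infinite.
by case: K_inacc.
Qed.

Lemma finite_card_lt (T : Type) (A : set T) :
  finite_set A -> card_lt A [set: K].
Proof. by move=> /finite_set_countable/countable_card_lt. Qed.

Lemma card_lt_setU (A B : set K) :
  card_lt A [set: K] -> card_lt B [set: K] -> card_lt (A `|` B) [set: K].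
Proof.
move=> A_lt B_lt; have [f [f_inj _]] := inj_card_leT inaccessible_infinite.
case: K_inacc => _ K_reg _.
(* [regular] speaks of families indexed by a subset of [K], so the union of two sets is indexed by
   two distinct elements of [K]. *)
pose F (i : K) := if `[< i = f 0 >] then A else B.
apply: (@card_le_lt _ _ _ _ (\bigcup_(i in [set f 0; f 1]) F i)).
  apply: subset_card_le => x [Ax|Bx]; [exists (f 0)|exists (f 1)];
    rewrite /F /=; auto.
    by rewrite asboolT.
  by rewrite asboolF // => /f_inj.
apply: K_reg; first exact/finite_card_lt/finite_set2.
by move=> i _; rewrite /F; case: ifP.
Qed.

Lemma card_lt_powerset (X : Type) :
  card_lt [set: X] [set: K] -> card_lt [set: set X] [set: K].
Proof.
move=> X_lt; have [f [f_inj _]] := inj_card_leT X_lt.1.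
case: K_inacc => _ _ /(_ (range f)) lim.
have /lim := card_le_lt (card_image_le f [set: X]) X_lt.
apply: card_le_lt; apply: (@card_leT_inj _ _ (fun B => f @` B)).
  suff sub B C : f @` B = f @` C -> B `<=` C.
    by move=> B C E; apply/seteqP; split; apply: sub.
  move=> E x Bx; have : (f @` C) (f x) by rewrite -E; exists x.
  by move=> [y Cy /f_inj <-].
by move=> _ [B _ <-] _ [x _ <-]; exists x.
Qed.

(** Pairs are coded in the double power set of a small set [S] that contains copies of both factors;
    the strong limit property, used twice, bounds it. *)
Lemma card_lt_prod (X Y : Type) :
  card_lt [set: X] [set: K] -> card_lt [set: Y] [set: K] ->
  card_lt [set: X * Y] [set: K].
Proof.
move=> X_lt Y_lt; have [f [f_inj _]] := inj_card_leT X_lt.1.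
have [g [g_inj _]] := inj_card_leT Y_lt.1.
pose S := range f `|` range g.
have S_lt : card_lt [set: S] [set: K].
  have := card_setT S; rewrite card_eq_le => /andP[S_le _].
  apply: (card_le_lt S_le).
  apply: card_lt_setU; [apply: card_le_lt X_lt|apply: card_le_lt Y_lt];
    exact: card_image_le.
have fS x : S (f x) by left; exists x.
have gS y : S (g y) by right; exists y.
pose f' x : S := SigSub (mem_set (fS x)).
pose g' y : S := SigSub (mem_set (gS y)).
have := card_lt_powerset (card_lt_powerset S_lt); apply: card_le_lt.
(* Kuratowski pairs *)
apply: (@card_leT_inj _ _
  (fun z => [set [set f' z.1]; [set f' z.1; g' z.2]])) => //.
have set2_inj (T : Type) (a b c : T) : [set a; b] = [set a; c] -> b = c.
  move=> E.
  have : [set a; c] b by rewrite -E; right.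
  have : [set a; b] c by rewrite E; right.
  by move=> [->|->] // [].
have set12 (T : Type) (a b c : T) : [set a] = [set b; c] -> a = b.
  by move=> E; have : [set a] b by rewrite E; left.
move=> [x y] [x' y'] /= E.
have ff : f' x = f' x'.
  have : [set [set f' x']; [set f' x'; g' y']] [set f' x] by rewrite -E; left.
  by move=> [E1|E1]; [have : [set f' x'] (f' x) by rewrite -E1|apply: set12 E1].
rewrite -ff in E.
have /(congr1 val)/g_inj -> := set2_inj _ _ _ _ (set2_inj _ _ _ _ E).
by have /(congr1 val)/f_inj -> := ff.
Qed.

(** A list is determined by its graph, a subset of [nat * X]. *)
Lemma card_lt_seq (X : Type) :
  card_lt [set: X] [set: K] -> card_lt [set: seq X] [set: K].
Proof.
move=> X_lt.
have nat_lt := countable_card_lt (countableP [set: nat]).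
have := card_lt_powerset (card_lt_prod nat_lt X_lt).
apply: card_le_lt.
apply: (@card_leT_inj _ _ (fun s => [set z | onth s z.1 = Some z.2])) => //.
move=> s t E; apply/eq_from_onth => i.
have H x : onth s i = Some x <-> onth t i = Some x.
  by have /(congr1 (fun A => A (i, x)))/= -> := E.
case Es: (onth s i) => [x|]; first by move/H: Es.
by case Et: (onth t i) => [x|] //; move/H: Et; rewrite Es.
Qed.

Lemma card_lt_sum (X Y : Type) :
  card_lt [set: X] [set: K] -> card_lt [set: Y] [set: K] ->
  card_lt [set: X + Y] [set: K].
Proof.
move=> /card_lt_powerset X_lt /card_lt_powerset Y_lt.
have := card_lt_prod X_lt Y_lt; apply: card_le_lt.
pose f (z : X + Y) : set X * set Y :=
  match z with inl x => ([set x], set0) | inr y => (set0, [set y]) end.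
have inj1 (T : Type) (x y : T) : [set x] = [set y] -> x = y.
  by move=> E; have : [set y] x by rewrite -E.
have n0 (T : Type) (x : T) : [set x] <> set0.
  by move=> E; have : set0 x by rewrite -E.
apply: (@card_leT_inj _ _ f) => // -[x|y] [x'|y'] E.
- by rewrite (inj1 _ _ _ (congr1 fst E)).
- by case: (n0 _ _ (congr1 fst E)).
- by case: (n0 _ _ (esym (congr1 fst E))).
- by rewrite (inj1 _ _ _ (congr1 snd E)).
Qed.

End Inaccessible.

(** * Formulas coded as words over a small alphabet *)

Section Encoding.
Variable L : signature.
Let letter := (nat + (fun_symb L + rel_symb L))%type.

(** Injectivity alone does not survive concatenation; unique readability at the front of a longer
    word does, and it carries the inductions below. *)
Definition prefix_code (T : Type) (c : T -> seq letter) : Prop :=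
  forall x y s t, c x ++ s = c y ++ t -> x = y /\ s = t.

Fixpoint encode_term (V : Type) (c : V -> seq letter) (t : term L V) :
    seq letter :=
  match t with
  | TVar v => inl 0 :: c v
  | TApp f ts =>
    inl 1 :: inr (inl f) ::
      flatten [seq encode_term c (ts i) | i <- enum 'I_(fun_arity f)]
  end.

Definition encode_option (V : Type) (c : V -> seq letter) (v : option V) :
    seq letter := if v is Some w then inl 1 :: c w else [:: inl 0].

Fixpoint encode (V : Type) (p : form L V) : (V -> seq letter) -> seq letter :=
  match p with
  | FBot => fun=> [:: inl 0]
  | FEq t s => fun c => inl 1 :: encode_term c t ++ encode_term c s
  | FRel r ts => fun c =>
    inl 2 :: inr (inr r) ::
      flatten [seq encode_term c (ts i) | i <- enum 'I_(rel_arity r)]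
  | FImp p q => fun c => inl 3 :: encode p c ++ encode q c
  | FAll q => fun c => inl 4 :: encode q (encode_option c)
  end.

(** The arity fixes the number of blocks, so they can be split off one after another without
    separators. *)
Lemma flatten_prefix (T : Type) (c : T -> seq letter) n (f g : 'I_n -> T) s t :
  (forall i y s t, c (f i) ++ s = c y ++ t -> f i = y /\ s = t) ->
  flatten [seq c (f i) | i <- enum 'I_n] ++ s =
  flatten [seq c (g i) | i <- enum 'I_n] ++ t -> f = g /\ s = t.
Proof.
move=> c_pref E.
have [fg ->] : (forall i, i \in enum 'I_n -> f i = g i) /\ s = t.
  elim: (enum _) E => //= i l IH; rewrite -!catA => /c_pref [fi /IH [fl ->]].
  by split=> // j; rewrite inE => /orP[/eqP->|/fl].
by split=> //; apply/funext => i; apply: fg; rewrite mem_enum.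
Qed.

Lemma encode_term_prefix (V : Type) (c : V -> seq letter) :
  prefix_code c -> prefix_code (encode_term c).
Proof.
move=> c_pref; elim=> [v|f ts IH] [w|g us] s t //= [].
  by move=> /c_pref [-> ->].
move=> fg; case: g / fg us => us.
by move=> /(flatten_prefix IH) [-> ->].
Qed.

Lemma encode_option_prefix (V : Type) (c : V -> seq letter) :
  prefix_code c -> prefix_code (encode_option c).
Proof.
move=> c_pref [v|] [w|] s t //= []; last by move=> ->.
by move=> /c_pref [-> ->].
Qed.

Lemma encode_prefix (V : Type) (p q : form L V) (c : V -> seq letter) s t :
  prefix_code c -> encode p c ++ s = encode q c ++ t -> p = q /\ s = t.
Proof.
elim: p q c s t => {V} [V|V t1 t2|V r ts|V p IHp q IHq|V q IHq]
  [|u1 u2|r' us|p' q'|q'] c s t c_pref //= [].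
- by move=> ->.
- have t_pref := encode_term_prefix c_pref.
  by rewrite -!catA => /t_pref [-> /t_pref [-> ->]].
- move=> rr; case: r' / rr us => us.
  have t_pref := encode_term_prefix c_pref.
  by move=> /(flatten_prefix (fun i => t_pref (ts i))) [-> ->].
- by rewrite -!catA => /(IHp _ _ _ _ c_pref) [-> /(IHq _ _ _ _ c_pref) [-> ->]].
- by move=> /(IHq _ _ _ _ (encode_option_prefix c_pref)) [-> ->].
Qed.

Lemma card_lt_formulas (K : Type) (m : nat) :
  inaccessible K -> card_lt [set: fun_symb L + rel_symb L] [set: K] ->
  card_lt [set: {n : nat & form L ('I_n + 'I_m)}] [set: K].
Proof.
move=> K_inacc L_lt.
have nat_lt := countable_card_lt K_inacc (countableP [set: nat]).
have := card_lt_seq K_inacc (card_lt_sum K_inacc nat_lt L_lt).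
apply: card_le_lt.
pose c n (v : 'I_n + 'I_m) : seq letter := [:: inl (pickle v)].
have c_pref n : prefix_code (c n).
  by move=> v w s t [/(pcan_inj pickleK) -> ->].
(* The number [n] is written first, since it fixes the type of the formula encoded by the rest of
   the word. *)
apply: (@card_leT_inj _ _
  (fun p => inl (tag p) :: encode (tagged p) (@c (tag p)))) => //.
move=> [n p] [n' p'] [/= nn]; case: n' / nn p' => p' E.
have := @encode_prefix _ p p' (@c n) [::] [::] (@c_pref n).
by rewrite !cats0 => /(_ E) [->].
Qed.

End Encoding.

(** * Formulas and types *)

Fixpoint rename_term (L : signature) (V W : Type) (r : V -> W)
    (t : term L V) : term L W :=
  match t with
  | TVar v => TVar L (r v)
  | TApp f ts => TApp (fun i => rename_term r (ts i))
  end.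

Fixpoint rename (L : signature) (V : Type) (p : form L V) :
    forall W : Type, (V -> W) -> form L W :=
  match p with
  | FBot => fun W _ => FBot L W
  | FEq t s => fun W r => FEq (rename_term r t) (rename_term r s)
  | FRel R ts => fun W r => FRel (fun i => rename_term r (ts i))
  | FImp p1 p2 => fun W r => FImp (rename p1 r) (rename p2 r)
  | FAll q => fun W r => FAll (rename q (omap r))
  end.

Definition form_not (L : signature) (V : Type) (p : form L V) : form L V :=
  FImp p (FBot L V).

Definition form_ex (L : signature) (V : Type) (p : form L (option V)) :
  form L V := form_not (FAll (form_not p)).

Definition form_and (L : signature) (V : Type) (p q : form L V) : form L V :=
  form_not (FImp p (form_not q)).

Fixpoint form_conj (L : signature) (V : Type) (s : seq (form L V)) : form L V :=
  if s is p :: s' then form_and p (form_conj s') else form_not (FBot L V).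

(* List-based finiteness: [form L V] has no eqType structure. *)
Fixpoint all_in (T : Type) (P : T -> Prop) (s : seq T) : Prop :=
  if s is x :: s' then P x /\ all_in P s' else True.

Lemma all_in_cat (T : Type) (P : T -> Prop) (s t : seq T) :
  all_in P (s ++ t) <-> all_in P s /\ all_in P t.
Proof. by elim: s => [|x s IH] /=; tauto. Qed.

Lemma all_in_sub (T : Type) (P Q : T -> Prop) (s : seq T) :
  (forall x, P x -> Q x) -> all_in P s -> all_in Q s.
Proof. by move=> PQ; elim: s => //= x s IH [/PQ ? /IH]. Qed.

Lemma all_in_map (S T : Type) (P : T -> Prop) (f : S -> T) (s : seq S) :
  all_in P (map f s) <-> all_in (P \o f) s.
Proof. by elim: s => [|x s IH] //=; tauto. Qed.

Definition ordinal0_elim (T : Type) (i : 'I_0) : T :=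
  let: Ordinal _ lt0 := i in match notF lt0 with end.

Section Semantics.
Variables (L : signature) (U : structure L).
Implicit Types V W : Type.

Lemma eval_rename V W (r : V -> W) (t : term L V) (e : W -> U) :
  eval e (rename_term r t) = eval (e \o r) t.
Proof.
by elim: t => //= f ts IH; congr (finterp _); apply/funext => i; apply: IH.
Qed.

Lemma bind_omap V W (r : V -> W) (a : U) (e : W -> U) :
  bind a e \o omap r = bind a (e \o r).
Proof. by apply/funext => -[]. Qed.

Lemma sat_rename V W (r : V -> W) (p : form L V) (e : W -> U) :
  sat (rename p r) e <-> sat p (e \o r).
Proof.
elim: p W r e => {V} [V|V t s|V R ts|V p IHp q IHq|V q IHq] W r e //=.
- by rewrite !eval_rename.
- suff -> : (fun i => eval e (rename_term r (ts i))) =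
    (fun i => eval (e \o r) (ts i)) by [].
  by apply/funext => i; rewrite eval_rename.
- by rewrite IHp IHq.
- by split=> H a; move: (H a); rewrite IHq bind_omap.
Qed.

Lemma sat_ex V (p : form L (option V)) (e : V -> U) :
  sat (form_ex p) e <-> exists a, sat p (bind a e).
Proof.
split=> [/= H|[a pa] /= H]; last exact: H pa.
by apply: contrapT => K; apply: H => a pa; apply: K; exists a.
Qed.

Lemma sat_and V (p q : form L V) (e : V -> U) :
  sat (form_and p q) e <-> sat p e /\ sat q e.
Proof.
split=> [/= H|[pe qe] /= H]; last exact: H.
by split; apply: contrapT => K; apply: H => pe qe; exact: K.
Qed.

Lemma sat_conj V (s : seq (form L V)) (e : V -> U) :
  sat (form_conj s) e <-> all_in (fun p => sat p e) s.
Proof.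
elim: s => [|p s IH]; first by split=> _ ; [|exact: id].
by rewrite [form_conj _]/= sat_and IH.
Qed.

Lemma term_finite_support V (t : term L V) :
  exists (W : finType) (t' : term L W) (r : W -> V), t = rename_term r t'.
Proof.
elim: t => [v|f ts IH].
  by exists unit, (TVar L tt), (fun=> v).
have [W HW] := choice IH.
have [t' Ht'] := all_sig (fun i => cid (HW i)).
have [r Hr] := all_sig (fun i => cid (Ht' i)).
exists {i : 'I_(fun_arity f) & W i},
  (TApp (fun i => rename_term (fun w => Tagged W w) (t' i))),
  (fun w => r (tag w) (tagged w)).
rewrite /=; congr TApp; apply/funext => i; rewrite {1}Hr.
by elim: (t' i) => //= g us IHu; congr TApp; apply/funext => j; apply: IHu.
Qed.

(** Variables may form an infinite type, for instance [U] itself when parameters serve as variables.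
    The reduction to finitely many is used for unions of chains of elementary maps and for replacing
    parameters by a finite tuple. *)
Lemma form_finite_support V (p : form L V) :
  exists (W : finType) (p' : form L W) (r : W -> V),
    forall e : V -> U, sat p e <-> sat p' (e \o r).
Proof.
elim: p => {V} [V|V t s|V R ts|V p IHp q IHq|V q IHq].
- by exists void, (FBot L void), (fun v : void => match v with end).
- have [W [t' [r ->]]] := term_finite_support t.
  have [X [s' [u ->]]] := term_finite_support s.
  exists (W + X)%type, (FEq (rename_term inl t') (rename_term inr s')),
    (fun w => match w with inl x => r x | inr y => u y end).
  by move=> e /=; rewrite !eval_rename.
- have [W HW] := choice (fun i => term_finite_support (ts i)).
  have [t' Ht'] := all_sig (fun i => cid (HW i)).
  have [r Hr] := all_sig (fun i => cid (Ht' i)).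
  exists {i : 'I_(rel_arity R) & W i},
    (FRel (fun i => rename_term (fun w => Tagged W w) (t' i))),
    (fun w => r (tag w) (tagged w)) => e /=.
  rewrite (_ : (fun i => eval _ (rename_term _ _)) = fun i => eval e (ts i)) //.
  by apply/funext => i; rewrite Hr !eval_rename.
- have [W [p' [r Hr]]] := IHp; have [X [q' [u Hu]]] := IHq.
  exists (W + X)%type, (FImp (rename p' inl) (rename q' inr)),
    (fun w => match w with inl x => r x | inr y => u y end).
  by move=> e /=; rewrite !sat_rename Hr Hu.
- have [W [q' [r Hr]]] := IHq.
  (* [W'] keeps the names of free variables; [insub] sends all other names, those of the bound
     variable, to [None]. *)
  pose W' := {w : W | isSome (r w)}.
  have getr (w : W') : {v : V | r (val w) = Some v}.
    by case: w => w /=; case: (r w) => // v _; exists v.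
  exists W', (FAll (rename q' insub)), (fun w => sval (getr w)) => e /=.
  suff E a : sat q (bind a e) <->
    sat (rename q' insub) (bind a (e \o (fun w => sval (getr w)))).
    by split=> H a; move: (H a); rewrite E.
  rewrite Hr sat_rename.
  rewrite (_ : bind a e \o r =
    bind a (e \o (fun w => sval (getr w))) \o insub)//.
  apply/funext => w /=; case: insubP => [w' _ <-|] /=.
    by case: (getr w') => v /= ->.
  by case: (r w).
Qed.

(** * Types in a finite tuple of variables *)

Definition sum_env V m (e : V -> U) (c : 'I_m -> U) (v : V + 'I_m) : U :=
  match v with inl x => e x | inr j => c j end.

(** Turns the first coordinate of the tuple into a fresh parameter [None]; this is the step of the
    inductions on the length of the tuple. *)
Definition shift_var V m (v : V + 'I_m.+1) : option V + 'I_m :=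
  match v with
  | inl x => inl (Some x)
  | inr i => if unlift ord0 i is Some j then inr j else inl None
  end.

Definition tuple_cons m (a : U) (c : 'I_m -> U) (i : 'I_m.+1) : U :=
  if unlift ord0 i is Some j then c j else a.

Lemma tuple_cons_eta m (c : 'I_m.+1 -> U) :
  c = tuple_cons (c ord0) (c \o lift ord0).
Proof.
by apply/funext => i; rewrite /tuple_cons; case: unliftP => [j ->|->].
Qed.

Lemma sat_shift V m (p : form L (V + 'I_m.+1)) (e : V -> U) a (c : 'I_m -> U) :
  sat (rename p (@shift_var V m)) (sum_env (bind a e) c) <->
  sat p (sum_env e (tuple_cons a c)).
Proof.
rewrite sat_rename (_ : _ \o _ = sum_env e (tuple_cons a c))//.
apply/funext => -[v|i] //=; rewrite /tuple_cons /=.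
by case: unliftP => //= j _.
Qed.

Lemma ex_tuple V m (p : form L (V + 'I_m)) :
  exists q : form L V, forall e : V -> U,
    sat q e <-> exists c, sat p (sum_env e c).
Proof.
elim: m V p => [|m IH] V p.
  exists (rename p (fun v =>
    match v with inl x => x | inr i => ordinal0_elim V i end)) => e.
  rewrite sat_rename; set g := _ \o _.
  have E c : sum_env e c = g by apply/funext => -[v|[]].
  by split=> [H|[c]]; [exists (ordinal0_elim U)|]; rewrite E.
have [q Hq] := IH _ (rename p (@shift_var V m)).
exists (form_ex q) => e; rewrite sat_ex; split.
  by move=> [a /Hq [c]]; rewrite sat_shift; exists (tuple_cons a c).
move=> [c pc]; exists (c ord0); apply/Hq; exists (c \o lift ord0).
by rewrite sat_shift -tuple_cons_eta.
Qed.

Lemma small_bind V (e : V -> U) a :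
  inaccessible U -> small (range e) -> small (range (bind a e)).
Proof.
move=> U_inacc e_small.
have := card_lt_setU U_inacc e_small (finite_card_lt U_inacc (finite_set1 a)).
apply: card_le_lt; apply: subset_card_le => _ [[v|] _ <-]; last by right.
by left; exists v.
Qed.

(** Saturation for parameters indexed by any type [V], possibly with repetitions: renaming each
    index to its value gives a type over the small set [range e]. *)
Lemma saturated_type (U_sat : saturated U) V (e : V -> U)
    (P : set (form L (option V))) :
  small (range e) ->
  (forall s, all_in P s -> exists a, all_in (fun p => sat p (bind a e)) s) ->
  exists a, forall p, P p -> sat p (bind a e).
Proof.
move=> e_small P_fin.
have re v : range e (e v) by exists v.
pose g (v : V) : range e := SigSub (mem_set (re v)).
pose Q := [set rename p (omap g) | p in P].
have E a p : sat (rename p (omap g)) (bind a (fun c : range e => val c)) <->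
    sat p (bind a e).
  by rewrite sat_rename bind_omap.
case: (U_sat (range e) Q e_small) => [q q_fin qQ|a Ha]; last first.
  by exists a => p Pp; apply/E; apply: Ha; exists p.
(* The finite set [q] is pulled back to a list of members of [P]. The clause
   [forall Q, all_in Q s -> Q p] expresses that [p] occurs in [s]. *)
have [s Ps sq] : exists2 s, all_in P s & forall x, q x ->
    exists2 p, x = rename p (omap g) & forall Q, all_in Q s -> Q p.
  pose T := {classic form L (option (range e))}.
  have [l ql] := (finite_seqP (q : set T)).1 q_fin.
  have lQ x : x \in l -> Q x by move=> xl; apply: qQ; rewrite ql.
  suff [s Ps sl] : exists2 s, all_in P s & forall x, x \in l ->
      exists2 p, x = rename p (omap g) & forall Q, all_in Q s -> Q p.
    by exists s => // x; rewrite ql => /sl.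
  elim: (l) lQ => [|y l' IH] lQ; first by exists [::].
  have [p Pp py] := lQ y (mem_head _ _).
  have [|s Ps sl] := IH.
    by move=> x xl; apply: lQ; rewrite inE xl orbT.
  exists (p :: s) => // x; rewrite inE => /orP[/eqP->|/sl [p' -> sp']].
    by exists p => //= P' [].
  by exists p' => //= P' [_ /sp'].
have [a Ha] := P_fin s Ps; exists a => x /sq [p -> sp]; apply/E.
exact: sp Ha.
Qed.

(** The coordinates are realized one at a time, each realized one becoming a parameter for the
    rest. *)
Lemma saturated_tuple_type (U_sat : saturated U) (U_inacc : inaccessible U)
    V m (e : V -> U) (P : set (form L (V + 'I_m))) :
  small (range e) ->
  (forall s, all_in P s -> exists c, all_in (fun p => sat p (sum_env e c)) s) ->
  exists c, forall p, P p -> sat p (sum_env e c).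
Proof.
elim: m V e P => [|m IH] V e P e_small P_fin.
  have [c _] := P_fin [::] I; exists c => p Pp.
  have [//|c' [pc' _]] := P_fin [:: p].
  by rewrite (_ : c = c')//; apply/funext => -[].
(* The type of the first coordinate: for each finite part of [P], the remaining coordinates can be
   chosen to satisfy it. *)
pose Q := [set q : form L (option V) | exists2 s, all_in P s &
  forall e' : option V -> U, sat q e' <-> exists c,
    sat (rename (form_conj s) (@shift_var V m)) (sum_env e' c)].
have [|a Ha] := saturated_type U_sat (P := Q) e_small.
  move=> l lQ.
  have [s Ps sl] : exists2 s, all_in P s & forall c,
    all_in (fun p => sat p (sum_env e c)) s ->
    all_in (fun q => sat q (bind (c ord0) e)) l.
    elim: l lQ => [|q l IHl] /=; first by exists [::].
    move=> [[s Ps qs] /IHl [t Pt lt]]; exists (s ++ t); first exact/all_in_cat.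
    move=> c /all_in_cat [/sat_conj cs /lt]; split => //; apply/qs.
    by exists (c \o lift ord0); rewrite sat_shift -tuple_cons_eta.
  by have [c /sl] := P_fin s Ps; exists (c ord0).
have [|s sP|c Hc] := IH _ (bind a e) [set rename p (@shift_var V m) | p in P].
- exact: small_bind.
- have [t Pt ->] : exists2 t, all_in P t &
      s = map (fun p => rename p (@shift_var V m)) t.
    elim: s sP => [|q s IHs] /=; first by exists [::].
    by move=> [[p Pp <-] /IHs [t Pt ->]]; exists (p :: t).
  have [q Hq] := ex_tuple (rename (form_conj t) (@shift_var V m)).
  have /Hq [c] : sat q (bind a e) by apply: Ha; exists t.
  rewrite sat_shift sat_conj => Hc; exists c; apply/all_in_map.
  by apply: all_in_sub Hc => p /=; rewrite sat_shift.
- exists (tuple_cons a c) => p Pp; rewrite -sat_shift; apply: Hc.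
  by exists p.
Qed.

End Semantics.

(** * Homogeneity of saturated structures *)

Definition trichotomous (K : Type) (R : K -> K -> Prop) : Prop :=
  forall x y, [\/ R x y, x = y | R y x].

Lemma wf_min (K : Type) (R : K -> K -> Prop) (P : set K) :
  well_founded R -> P !=set0 -> exists2 z, P z & forall x, P x -> ~ R x z.
Proof.
move=> R_wf [x Px]; elim/(well_founded_ind R_wf): x Px => x IH Px.
have [[y [Py yx]]|H] := pselect (exists y, P y /\ R y x); first exact: IH Py.
by exists x => // y Py yx; apply: H; exists y.
Qed.

(** Otherwise [x], [y], [z] would lie on a cycle, a nonempty set without minimal element. *)
Lemma trichotomous_wf_trans (K : Type) (R : K -> K -> Prop) (x y z : K) :
  well_founded R -> trichotomous R -> R x y -> R y z -> R x z.
Proof.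
move=> R_wf R_tri xy yz.
have [] := wf_min (P := [set x; y; z]) R_wf; first by exists x; left; left.
have [//|xz|zx] := R_tri x z.
  by move=> _ [[->|->]|->] H; [case: (H y)|case: (H x)|case: (H y)];
    rewrite /= ?xz; auto; rewrite -?xz.
by move=> _ [[->|->]|->] H; [case: (H z)|case: (H x)|case: (H y)];
  rewrite /=; auto.
Qed.

Lemma exists_well_order (K : Type) :
  exists2 R : K -> K -> Prop, well_founded R & trichotomous R.
Proof.
pose T : eqType := {classic K}.
have [R R_wo] := wochoice.well_ordering_principle T.
(* [R] is a reflexive order in which every nonempty set has a unique least element; this is its
   strict part. *)
exists (fun x y : K => ~~ R y x) => [x|x y].
  apply: contrapT => nx.
  pose A : pred T := fun y => `[< ~ Acc (fun x y : K => ~~ R y x) y >].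
  have [|z [[/asboolP nz zmin] _]] := R_wo A.
    by exists x; apply/asboolP.
  apply: nz; split=> y; apply: contraNP => ny.
  by apply: zmin; apply/asboolP.
have [|z [[zA zmin] zuniq]] := R_wo (pred2 (x : T) y).
  by exists x; rewrite inE eqxx.
have xA : (x : T) \in pred2 (x : T) y by rewrite inE eqxx.
have yA : (y : T) \in pred2 (x : T) y by rewrite inE eqxx orbT.
have [Ryx|nRyx] := boolP (R y x); last by apply: Or31.
have [Rxy|nRxy] := boolP (R x y); last by apply: Or33.
have R1 (u : T) : R u u.
  have [|v [[/eqP-> vmin] _]] := R_wo (pred1 u); first by exists u; rewrite inE.
  by apply: vmin; rewrite inE.
apply: Or32; rewrite -(zuniq x) ?(zuniq y)//; split=> // u;
  by rewrite inE => /orP[/eqP->|/eqP->].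
Qed.

(** If some initial segment is as large as [K], the least point [x1] with such a segment is taken,
    and the order is pulled back along an injection of [K] into that segment. *)
Lemma exists_small_well_order (K : Type) :
  exists R : K -> K -> Prop, [/\ well_founded R, trichotomous R &
    forall x, card_lt [set y | R y x] [set: K]].
Proof.
have [R R_wf R_tri] := exists_well_order K.
pose big := [set x | [set: K] #<= [set y | R y x]].
have [[x0 x0_big]|no_big] := pselect (big !=set0); last first.
  exists R; split=> // x; split; first exact: card_leT.
  by move=> x_big; apply: no_big; exists x.
have [x1 x1_big x1_min] := wf_min R_wf (ex_intro _ _ x0_big).
have [g [g_inj gx1]] := inj_card_leT x1_big.
exists (fun x y => R (g x) (g y)); split.
- move=> x; move: {2}(g x) (erefl (g x)) => u.
  elim/(well_founded_ind R_wf): u x => u IH x gx.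
  by split=> y yx; apply: IH (erefl _); rewrite -gx.
- move=> x y; have [xy|/g_inj xy|xy] := R_tri (g x) (g y);
    [exact: Or31|exact: Or32|exact: Or33].
- move=> x; split; first exact: card_leT.
  move=> x_big; apply: (x1_min (g x)); last by apply: gx1; exists x.
  apply: (card_le_trans x_big).
  have := inj_card_eq
    (in2W g_inj : {in [set y | R (g y) (g x)] &, injective g}).
  rewrite card_eq_le => /andP[_ le]; apply: (card_le_trans le).
  by apply: subset_card_le => _ [y yx <-].
Qed.

(** * Partial elementary maps and back-and-forth *)

Section Elementary.
Variables (L : signature) (U : structure L).

(** A partial elementary map presented by its graph; equality formulas force [G] to be functional
    and injective. *)
Definition elementary (G : set (U * U)) : Prop :=
  forall (V : Type) (p : form L V) (e : V -> U * U), (forall v, G (e v)) ->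
    (sat p (fst \o e) <-> sat p (snd \o e)).

Lemma elementary_sub (G H : set (U * U)) :
  G `<=` H -> elementary H -> elementary G.
Proof. by move=> GH Hel V p e eG; apply: Hel => v; apply: GH. Qed.

Lemma elementary_inv (G : set (U * U)) :
  elementary G -> elementary [set z | G (z.2, z.1)].
Proof.
move=> Gel V p e eG; have := Gel V p (fun v => ((e v).2, (e v).1)) eG.
by rewrite /comp /=; tauto.
Qed.

(** A formula involves finitely many pairs, and these lie in a single member of the chain. *)
Lemma elementary_bigcup (I : Type) (P : set I) (G : I -> set (U * U)) :
  P !=set0 -> (forall i, P i -> elementary (G i)) ->
  (forall i j, P i -> P j -> G i `<=` G j \/ G j `<=` G i) ->
  elementary (\bigcup_(i in P) G i).
Proof.
move=> [i0 Pi0] Gel G_chain V p e eG.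
have [W [p' [r Hr]]] := form_finite_support U p; rewrite !Hr.
have [i Pi eGi] : exists2 i, P i & forall w, w \in enum W -> G i (e (r w)).
  elim: (enum W) => [|w l [i Pi IH]]; first by exists i0.
  have [j Pj wj] := eG (r w).
  have [ij|ji] := G_chain i j Pi Pj.
    by exists j => // w'; rewrite inE => /orP[/eqP->//|/IH/ij].
  by exists i => // w'; rewrite inE => /orP[/eqP->|/IH//]; apply: ji.
by apply: (Gel i Pi W p' (e \o r)) => w; apply: eGi; rewrite mem_enum.
Qed.

(** The type of [a] over the domain of [G], carried over to the range, is finitely satisfiable
    because existential formulas are preserved. *)
Lemma elementary_extend (U_sat : saturated U) (G : set (U * U)) (a : U) :
  elementary G -> small (snd @` G) ->
  exists b, elementary (G `|` [set (a, b)]).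
Proof.
move=> Gel G_small.
pose e0 (z : G) : U * U := val z.
have e0G z : G (e0 z) by apply: set_mem (valP z).
pose P := [set p : form L (option G) | sat p (bind a (fst \o e0))].
have [||b Hb] := saturated_type U_sat (e := snd \o e0) (P := P).
- apply: card_le_lt G_small; apply: subset_card_le => _ [z _ <-].
  by exists (e0 z).
- move=> s Ps.
  have /sat_ex [b /sat_conj Hb] : sat (form_ex (form_conj s)) (snd \o e0).
    by apply/Gel => //; apply/sat_ex; exists a; apply/sat_conj.
  by exists b.
exists b => V p e eG.
pose r v : option G := match pselect (G (e v)) with
  left h => Some (SigSub (mem_set h)) | right _ => None end.
have er (h : (U * U) -> U) (c : U) : h (a, b) = c ->
    h \o e = bind c (h \o e0) \o r.
  move=> <-; apply/funext => v /=; rewrite /r; case: pselect => //= nG.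
  by have [//|->] := eG v.
rewrite (er fst a)// (er snd b)// -!sat_rename; split; first exact: Hb.
move=> pb; apply: contrapT => npa.
by have /= := Hb (form_not (rename p r)) npa; apply.
Qed.

(** Preservation of atomic formulas is enough: equality makes [G] the graph of a bijection, and the
    other atoms make it an automorphism. *)
Lemma elementary_automorphism (G : set (U * U)) :
  elementary G -> (forall x, exists y, G (x, y)) ->
  (forall y, exists x, G (x, y)) ->
  exists2 f, automorphism f & forall z, G z -> f z.1 = z.2.
Proof.
move=> Gel /choice [f Gf] /choice [g Gg].
have Geq z z' : G z -> G z' -> (z.1 = z'.1 <-> z.2 = z'.2).
  move=> Gz Gz'.
  pose e (b : bool) := if b then z else z'.
  have := Gel bool (FEq (TVar L true) (TVar L false)) e.
  by apply; case.
have fE z : G z -> f z.1 = z.2.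
  by move=> Gz; have /= <- := Geq _ _ (Gf z.1) Gz.
exists f => //; split.
- exists g => x.
    by have /= -> := Geq _ _ (Gg (f x)) (Gf x).
  exact: (fE _ (Gg x)).
- move=> h c; pose e (v : option 'I_(fun_arity h)) :=
    let x := bind (finterp c) c v in (x, f x).
  pose q := FEq (TVar L None) (@TApp L _ h (fun i => TVar L (Some i))).
  have /= [H _] := Gel _ q e (fun v => Gf _).
  exact: H.
- move=> r c.
  have /= H := Gel _ (FRel (fun i => TVar L i)) (fun i => (c i, f (c i)))
    (fun v => Gf _).
  by rewrite H.
Qed.

(** Back-and-forth along a well-order with small initial segments: stage [a] adds an image and a
    preimage of [a], so the map built before each stage is small. *)
Theorem homogeneity (U_sat : saturated U) (U_inacc : inaccessible U)
    (G : set (U * U)) :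
  elementary G -> small (fst @` G) -> small (snd @` G) ->
  exists2 f, automorphism f & forall z, G z -> f z.1 = z.2.
Proof.
move=> Gel G_dom G_ran.
have [R [R_wf R_tri R_small]] := exists_small_well_order U.
have [_ U_reg _] := U_inacc.
have small1 (D : set (U * U)) (h : U * U -> U) z :
    small (h @` D) -> small (h @` (D `|` [set z])).
  move=> D_small; rewrite image_setU image_set1.
  by apply: card_lt_setU => //; apply/finite_card_lt/finite_set1.
(* The conditions on [D] stand inside the existential, so that choice yields a total [pick];
   [(a, a)] is the default value. *)
have ext (D : set (U * U)) (a : U) : exists z : U * U,
    elementary D -> small (fst @` D) -> small (snd @` D) ->
    elementary (D `|` [set (a, z.1)] `|` [set (z.2, a)]).
  have [[Del D1 D2]|nD] := pselect
    [/\ elementary D, small (fst @` D) & small (snd @` D)]; last first.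
    by exists (a, a) => ? ? ?; case: nD.
  have [y Dy] := elementary_extend U_sat a Del D2.
  have [|x Dx] := elementary_extend U_sat a (elementary_inv Dy).
    apply: card_le_lt (small1 D fst (a, y) D1).
    by apply: subset_card_le => _ [[u v] /= H <-]; exists (v, u).
  exists (y, x) => _ _ _; apply: elementary_sub (elementary_inv Dx).
  by move=> [u v] [H|[-> ->]]; [left|right].
have [pick Hpick] := choice (fun Da => ext Da.1 Da.2).
pose step (P : U -> Prop) (H : forall b, P b -> U * U) : set (U * U) :=
  G `|` [set z | exists b (Pb : P b),
    z = (b, (H b Pb).1) \/ z = ((H b Pb).2, b)].
(* The value at [a] is a pair: the image of [a], then its preimage. *)
pose F a (H : forall b, R b a -> U * U) : U * U := pick (step (R^~ a) H, a).
pose H := Fix R_wf (fun=> (U * U)%type) F.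
have HE a : H a = pick (step (R^~ a) (fun b _ => H b), a).
  rewrite /H Fix_eq // => {}a f g fg; rewrite /F (_ : f = g)//.
  by apply/functional_extensionality_dep => b; apply/funext => h; apply: fg.
pose below a := step (R^~ a) (fun b _ => H b).
pose upto a := below a `|` [set (a, (H a).1)] `|` [set ((H a).2, a)].
have R_trans := fun x y z => @trichotomous_wf_trans U R x y z R_wf R_tri.
have sub_lt a b : R a b -> upto a `<=` below b.
  move=> ab z [[[Gz|[c [ca zc]]]|->]|->]; first by left.
  - by right; exists c, (R_trans _ _ _ ca ab).
  - by right; exists a, ab; left.
  - by right; exists a, ab; right.
have sub_upto a : below a `<=` upto a by move=> z; left; left.
have upto_chain a b : upto a `<=` upto b \/ upto b `<=` upto a.
  have [/sub_lt ab|->|/sub_lt ba] := R_tri a b; [left|by left|right].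
    exact: subset_trans ab (sub_upto b).
  exact: subset_trans ba (sub_upto a).
have below_small a : small (fst @` below a) /\ small (snd @` below a).
  have S (c : U -> U) : small ([set b | R b a] `|` [set c b | b in R^~ a]).
    apply: card_lt_setU => //; apply: card_le_lt (R_small a).
    exact: card_image_le.
  split;
    [apply: card_le_lt (card_lt_setU U_inacc G_dom (S (fun b => (H b).2)))|
     apply: card_le_lt (card_lt_setU U_inacc G_ran (S (fun b => (H b).1)))];
    apply: subset_card_le => _ [z [Gz|[b [ba [->|->]]]] <-].
  - by left; exists z.
  - by right; left.
  - by right; right; exists b.
  - by left; exists z.
  - by right; right; exists b.
  - by right; left.
have base_chain a : G `<=` upto a by move=> z Gz; left; left; left.
have upto_el a : elementary (upto a).
  elim/(well_founded_ind R_wf): a => a IH.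
  have [D1 D2] := below_small a.
  rewrite /upto HE; apply: (Hpick (below a, a)) => //=.
  (* The index [None] stands for [G], which keeps the union nonempty at the least stage. *)
  pose D (o : option U) := if o is Some b then upto b else G.
  pose I := [set o | if o is Some b then R b a else True].
  apply: (@elementary_sub _ (\bigcup_(o in I) D o)).
    move=> z [Gz|[b [ba zb]]]; first by exists None.
    by exists (Some b) => //; case: zb => ->; [left; right|right].
  apply: elementary_bigcup; first by exists None.
    by move=> [b|] //; apply: IH.
  move=> [b|] [c|] _ _ /=; [exact: upto_chain|right; exact: base_chain|
    left; exact: base_chain|by left].
have [c0 _] := inaccessible_nonempty U_inacc.
have [|||f f_aut Gf] := @elementary_automorphism (\bigcup_a upto a).
- by apply: elementary_bigcup => //; exists c0.
- by move=> a; exists (H a).1; exists a => //; left; right.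
- by move=> a; exists (H a).2; exists a => //; right.
by exists f => // z Gz; apply: Gf; exists c0 => //; apply: base_chain.
Qed.

End Elementary.

(** * Average types of an ultrafilter *)

Fixpoint embed_term (L : signature) (m : nat) (V : Type) (t : term L V) :
    term (expand_sig L m) V :=
  match t with
  | TVar v => TVar _ v
  | TApp f ts => @TApp (expand_sig L m) V f (fun i => embed_term m (ts i))
  end.

Fixpoint embed (L : signature) (m : nat) (V : Type) (p : form L V) :
    form (expand_sig L m) V :=
  match p with
  | FBot => FBot _ _
  | FEq t s => FEq (embed_term m t) (embed_term m s)
  | FRel r ts =>
    @FRel (expand_sig L m) _ (Some r) (fun i => embed_term m (ts i))
  | FImp p q => FImp (embed m p) (embed m q)
  | FAll q => FAll (embed m q)
  end.

Lemma eval_embed (L : signature) (U : structure L) (m : nat)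
    (C : set ('I_m -> U)) (V : Type) (t : term L V) (e : V -> U) :
  @eval _ (expand C) V e (embed_term m t) = eval e t.
Proof.
elim: t => //= f ts IH.
by congr (@finterp L U f _); apply/funext => i; apply: IH.
Qed.

Lemma sat_embed (L : signature) (U : structure L) (m : nat)
    (C : set ('I_m -> U)) (V : Type) (p : form L V) (e : V -> U) :
  @sat _ (expand C) V (embed m p) e <-> sat p e.
Proof.
elim: p e => {V} [V|V t s|V r ts|V p IHp q IHq|V q IHq] e //=.
- by rewrite !eval_embed.
- rewrite (_ : (fun i => @eval _ (expand C) V e (embed_term m (ts i))) =
    fun i => eval e (ts i))//.
  by apply/funext => i; rewrite eval_embed.
- by rewrite IHp IHq.
- by split=> H a; apply/IHq; apply: H.
Qed.

(* The membership bit makes the conclusion invariant under C := ~` C, so that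
   approximability from above reduces to approximability from below. *)
Definition realizes_tuple_types (L : signature) (U : structure L) (m : nat)
    (C : set ('I_m -> U)) : Prop :=
  forall (b : bool) (V : Type) (e : V -> U) (P : set (form L (V + 'I_m))),
    small (range e) ->
    (forall s, all_in P s -> exists c,
       all_in (fun p => sat p (sum_env e c)) s /\ (C c <-> b)) ->
    exists c, (forall p, P p -> sat p (sum_env e c)) /\ (C c <-> b).

(** In the expanded signature membership in [C], or its negation, is one more formula, which can be
    added to the type. *)
Lemma saturated_set_tuple_types (L : signature) (U : structure L) (m : nat)
    (C : set ('I_m -> U)) :
  inaccessible U -> saturated_set C -> realizes_tuple_types C.
Proof.
move=> U_inacc C_sat b V e P e_small P_fin.
pose inC : form (expand_sig L m) (V + 'I_m) :=
  @FRel (expand_sig L m) _ None (fun i => TVar _ (inr i)).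
pose inCb := if b then inC else form_not inC.
have inCbE (c : 'I_m -> U) :
    @sat _ (expand C) _ inCb (@sum_env _ (expand C) V m e c) <-> (C c <-> b).
  rewrite /inCb; case: b {P_fin inCb} => /=.
    by split=> [Cc|[_]]; [split|apply].
  by split=> [nC|[nC _] /nC]; [split=> // /nC|].
pose Q := [set embed m p | p in P] `|` [set inCb].
have [s sQ|c Hc] :=
  @saturated_tuple_type _ (expand C) C_sat U_inacc V m e Q e_small.
- have [t Pt ts] : exists2 t, all_in P t & forall c : 'I_m -> U,
      all_in (fun p => sat p (sum_env e c)) t -> (C c <-> b) ->
      all_in (fun p => @sat _ (expand C) _ p (@sum_env _ (expand C) V m e c)) s.
    elim: s sQ => [|q s IH] /=; first by exists [::].
    move=> [[[p Pp <-]|->] /IH [t Pt ts]].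
      exists (p :: t) => // c [pc tc] Cc; split; last exact: ts.
      exact/sat_embed.
    by exists t => // c tc Cc; split; [apply/inCbE|apply: ts].
  by have [c [tc Cc]] := P_fin t Pt; exists c; apply: ts.
exists c; split; last by apply/inCbE; apply: Hc; right.
by move=> p Pp; apply/sat_embed; apply: Hc; left; exists p.
Qed.

Section Morley.
Variables (L : signature) (U : structure L) (m : nat).
Variables (F : set_system ('I_m -> U)) (B : set U).
Hypothesis F_ultra : UltraFilter F.
Hypothesis FB : F (tuples B).

(* The tuple [x] realizes over [B `|` S] the average type of [F]. *)
Definition average (S : set U) (x : 'I_m -> U) : Prop :=
  forall (V : Type) (p : form L (V + 'I_m)) (e : V -> U),
    (forall v, (B `|` S) (e v)) ->
    (sat p (sum_env e x) <-> F [set d | sat p (sum_env e d)]).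

Fixpoint entries (s : seq ('I_m -> U)) : set U :=
  if s is x :: s' then range x `|` entries s' else set0.

(** A finite Morley sequence of the average type, listed with the newest tuple first. *)
Fixpoint morley (s : seq ('I_m -> U)) : Prop :=
  if s is x :: s' then average (entries s') x /\ morley s' else True.

Fixpoint matching (s t : seq ('I_m -> U)) : set (U * U) :=
  match s, t with
  | x :: s', y :: t' => range (fun j => (x j, y j)) `|` matching s' t'
  | _, _ => [set z | B z.1 /\ z.1 = z.2]
  end.

Lemma matching_fst s t : fst @` matching s t `<=` B `|` entries s.
Proof.
elim: s t => [|x s IH] [|y t] _ [[u v] /= H <-] /=; try by left; case: H.
case: H => [[j _ [<- _]]|H]; first by right; left; exists j.
have [|Bu|su] := IH t u; first by exists (u, v).
  by left.
by right; right.
Qed.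

Lemma matching_snd s t : snd @` matching s t `<=` B `|` entries t.
Proof.
elim: s t => [|x s IH] [|y t] _ [[u v] /= H <-] /=;
  try by left; case: H => ? <-.
case: H => [[j _ [_ <-]]|H]; first by right; left; exists j.
have [|Bu|su] := IH t v; first by exists (u, v).
  by left.
by right; right.
Qed.

Lemma matching_base s t u : B u -> matching s t (u, u).
Proof. by move=> Bu; elim: s t => [|x s IH] [|y t] //=; right. Qed.

Lemma ultra_congr (X Y : set ('I_m -> U)) :
  (forall d, tuples B d -> X d <-> Y d) -> F X <-> F Y.
Proof.
move=> XY; split=> FX; apply: filterS (filterI FB FX) => d [Bd] /=.
  by move=> Xd; apply/XY.
by move=> Yd; apply/XY.
Qed.

(* Moving the last tuple into the filter leaves it ranging over tuples of [B],
   which every matching fixes. *)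
Lemma morley_elementary s t :
  size s = size t -> morley s -> morley t -> elementary (matching s t).
Proof.
elim: s t => [|x s IH] [|y t] //=.
  move=> _ _ _ V p e eB; suff -> : fst \o e = snd \o e by [].
  by apply/funext => v; have [] := eB v.
move=> [st] [x_av s_mor] [y_av t_mor]; have Mel := IH t st s_mor t_mor.
move=> V p e eM; pose M := matching s t.
(* Each variable is sorted by where its pair comes from: the older matching or the coordinates of
   the head tuples. *)
have /choice [r Hr] : forall v, exists z : {v | M (e v)} + 'I_m,
    match z with inl w => sval w = v | inr j => e v = (x j, y j) end.
  move=> v; have [[j _ <-]|Mv] := eM v; first by exists (inr j).
  by exists (inl (exist _ v Mv)).
pose e' (w : {v | M (e v)}) := e (sval w).
have e'M w : M (e' w) by case: w.
have E1 : fst \o e = sum_env (fst \o e') x \o r.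
  by apply/funext => v /=; case: (r v) (Hr v) => [w <-|j ->].
have E2 : snd \o e = sum_env (snd \o e') y \o r.
  by apply/funext => v /=; case: (r v) (Hr v) => [w <-|j ->].
rewrite E1 E2 -!sat_rename x_av; last first.
  by move=> w; exact: (@matching_fst s t _ (imageP fst (e'M w))).
rewrite y_av; last first.
  by move=> w; exact: (@matching_snd s t _ (imageP snd (e'M w))).
apply: ultra_congr => d Bd /=.
pose ed (z : {v | M (e v)} + 'I_m) :=
  match z with inl w => e' w | inr j => (d j, d j) end.
have := Mel _ (rename p r) ed.
have -> : fst \o ed = sum_env (fst \o e') d by apply/funext => -[].
have -> : snd \o ed = sum_env (snd \o e') d by apply/funext => -[].
by apply=> -[w|j]; [exact: e'M|exact: matching_base (Bd j)].
Qed.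

End Morley.

(** * Shattering by automorphic images of [C] *)

Section Alternation.
Variables (L : signature) (U : structure L) (m : nat).
Hypotheses (U_sat : saturated U) (U_inacc : inaccessible U).
Variables (F : set_system ('I_m -> U)) (A B : set U) (C : set ('I_m -> U)).
Hypotheses (F_ultra : UltraFilter F) (FB : F (tuples B)).
Hypotheses (AB : A `<=` B) (B_small : small B).
Variable b : nat -> 'I_m -> U.
Hypothesis b_average : forall n,
  average F B (\bigcup_(i in `I_n) range (b i)) (b n).
Hypothesis b_alt : forall n, C (b n) <-> ~~ odd n.

Lemma average_sub (S T : set U) x :
  S `<=` T -> average F B T x -> average F B S x.
Proof.
move=> ST x_av V p e eS; apply: x_av => v.
by case: (eS v) => ?; [left|right; apply: ST].
Qed.

(** From each pair of indices [i.*2], [i.*2.+1], the odd one is selected exactly when [chi i]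
    holds. *)
Fixpoint select (chi : nat -> bool) (k : nat) : seq ('I_m -> U) :=
  if k is k'.+1 then b (chi k' + k'.*2) :: select chi k' else [::].

Lemma size_select chi k : size (select chi k) = k.
Proof. by elim: k => //= k ->. Qed.

Lemma entries_select chi k :
  entries (select chi k) `<=` \bigcup_(i in `I_(k.*2)) range (b i).
Proof.
elim: k => //= k IH u [ku|/IH [i ik iu]]; last first.
  by exists i => //=; rewrite ltnS ltnW// ltnW.
exists (chi k + k.*2) => //=.
by case: (chi k) => /=; rewrite ?add1n ?add0n ltnS ?leqnSn.
Qed.

Lemma morley_select chi k : morley F B (select chi k).
Proof.
elim: k => //= k IH; split => //.
apply: (average_sub _ (@b_average _)) => u /entries_select [i ik iu].
exists i => //=.
by apply: leq_trans ik _; rewrite leq_addl.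
Qed.

Lemma matching_select chi psi k i j : i < k ->
  matching B (select chi k) (select psi k)
    (b (chi i + i.*2) j, b (psi i + i.*2) j).
Proof.
elim: k => //= k IH; rewrite ltnS leq_eqVlt => /orP[/eqP->|/IH ?].
  by left; exists j.
by right.
Qed.

Lemma small_entries (s : seq ('I_m -> U)) : small (entries s).
Proof.
elim: s => [|x s IH] /=; first exact/finite_card_lt/finite_set0.
apply: card_lt_setU => //; apply: finite_card_lt => //.
by apply: finite_image; apply: finite_finset.
Qed.

(** The map from [b i], [b j] to [b 0], [b 1] is elementary, so a repetition would give [b 0 = b 1],
    although only [b 0] is in [C]. *)
Lemma alternating_injective i j : i < j -> b i <> b j.
Proof.
move=> ij bij.
have M2 i' j' : i' < j' -> morley F B [:: b j'; b i'].
  move=> ij'; split; [|split => //].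
    apply: (average_sub _ (@b_average _)) => u /= [ui|//].
    by exists i'.
  by apply: (average_sub _ (@b_average _)) => u.
have el := @morley_elementary L U m F B F_ultra FB [:: b j; b i] [:: b 1; b 0]
  erefl (M2 _ _ ij) (M2 0 1 isT).
suff b01 : b 0 = b 1 by have [_ /(_ isT)] := b_alt 0; rewrite b01 => /b_alt.
apply/funext => l.
pose e (z : bool) := if z then (b j l, b 1 l) else (b i l, b 0 l).
have [|H _] := el _ (FEq (TVar L true) (TVar L false)) e.
  by case; [left; exists l|right; left; exists l].
by apply/esym/H; rewrite /= bij.
Qed.

Lemma alternation_shatters k :
  exists2 B0 : set ('I_m -> U), B0 #= `I_k & shatters (aut_orbit C A) B0.
Proof.
exists [set b i.*2 | i in `I_k].
  apply: inj_card_eq => i j _ _ bij.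
  by case: (ltngtP i j) => // ij; [have := @alternating_injective i.*2 j.*2
    |have := @alternating_injective j.*2 i.*2];
    rewrite ltn_double bij => /(_ ij).
move=> H HB.
(* The odd tuple, which is outside [C], is moved onto [b i.*2] exactly when [b i.*2] has to be left
   out of the image of [C]. *)
pose chi i := `[< ~ H (b i.*2) >].
pose s := select chi k; pose t := select (fun=> false) k.
have st : size s = size t by rewrite !size_select.
have el := morley_elementary F_ultra FB st (morley_select _ _)
  (morley_select _ _).
have [||f f_aut Mf] := homogeneity U_sat U_inacc el.
- apply: card_le_lt (card_lt_setU U_inacc B_small (small_entries s)).
  exact/subset_card_le/matching_fst.
- apply: card_le_lt (card_lt_setU U_inacc B_small (small_entries t)).
  exact/subset_card_le/matching_snd.
have fb i : i < k -> f \o b (chi i + i.*2) = b i.*2.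
  move=> ik; apply/funext => j.
  exact: Mf (matching_select chi (fun=> false) j ik).
exists ((fun c => f \o c) @` C).
  exists f => //; split=> // a Aa.
  exact: (Mf (a, a) (matching_base _ _ (AB Aa))).
have f_inj : injective f by case: f_aut => /bij_inj.
apply/seteqP; split=> [c Hc|_ [[i ik <-] [c Cc fc]]].
  split; first exact: HB.
  have [i ik ic] := HB c Hc; have := fb i ik.
  rewrite /chi asboolF; last by rewrite ic; apply.
  rewrite add0n ic => fc; exists c => //.
  by rewrite -ic; apply/b_alt; rewrite odd_double.
(* As [f] is injective, the selected tuple is the only preimage of [b i.*2]; being in [C], it has an
   even index. *)
have cE : c = b (chi i + i.*2).
  by apply/funext => j; apply: f_inj; have := congr1 (@^~ j) fc; rewrite -fb.
apply: contrapT => nH; move: Cc; rewrite cE => /b_alt.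
by rewrite oddD odd_double /chi asboolT.
Qed.

End Alternation.

(** * Approximation *)

Section Approximation.
Variables (L : signature) (U : structure L) (m : nat).
Hypotheses (U_sat : saturated U) (U_inacc : inaccessible U).
Variables (A : set U) (C : set ('I_m -> U)).
Hypotheses (A_small : small A) (C_types : realizes_tuple_types C).
Hypothesis C_VC : finite_VC (aut_orbit C A).

Definition solutions (p : form L (U + 'I_m)) : set ('I_m -> U) :=
  [set c | sat p (sum_env id c)].

Lemma average_realized (F : set_system ('I_m -> U)) (B S : set U) (b : bool) :
  UltraFilter F -> small (B `|` S) -> F C ->
  (forall p, solutions p `<=` C -> ~ F (solutions p)) ->
  exists x, average F B S x /\ (C x <-> b).
Proof.
move=> F_ultra BS_small FC F_avoid.
pose e (v : (B `|` S)) : U := val v.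
pose P := [set p : form L ((B `|` S) + 'I_m) | F [set d | sat p (sum_env e d)]].
have P_conj s : all_in P s ->
    F [set d | all_in (fun p => sat p (sum_env e d)) s].
  elim: s => [|p s IH] /=; first by move=> _; apply: filterT.
  by move=> [Pp /IH]; apply: filterI.
have [||x [Px Cx]] := @C_types b _ e P.
- apply: card_le_lt BS_small; apply: subset_card_le => _ [v _ <-].
  exact: set_mem (valP v).
- move=> s /P_conj Fs; apply: contrapT => none.
  case: b none => none.
    have [d [sd Cd]] := filter_ex (filterI Fs FC).
    by apply: none; exists d.
  (* If no solution of [s] is outside [C], the conjunction, with its parameters read in [U], defines
     a subset of [C] that belongs to [F]. *)
  pose q := rename (form_conj s) (fun z : (B `|` S) + 'I_m =>
    match z with inl v => inl (e v) | inr j => inr j end).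
  have qE d : solutions q d <-> all_in (fun p => sat p (sum_env e d)) s.
    rewrite /solutions /= sat_rename -sat_conj.
    by rewrite (_ : _ \o _ = sum_env e d)//; apply/funext => -[].
  apply: (F_avoid q).
    move=> d /qE sd; apply: contrapT => nC; apply: none; exists d.
    by split=> //; split=> // /nC.
  by apply: filterS Fs => d /qE.
exists x; split=> // V p e' e'BS.
pose r (z : V + 'I_m) : (B `|` S) + 'I_m :=
  match z with inl v => inl (SigSub (mem_set (e'BS v))) | inr j => inr j end.
have E d : sat p (sum_env e' d) <-> sat (rename p r) (sum_env e d).
  by rewrite sat_rename (_ : _ \o r = sum_env e' d)//; apply/funext => -[].
have FE : F [set d | sat p (sum_env e' d)] <->
    F [set d | sat (rename p r) (sum_env e d)].
  by split; apply: filterS => d /E.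
rewrite E FE; split; last exact: Px.
(* [F] decides every formula: one that is not in the average type has its negation there, and [x]
   satisfies it. *)
move=> px; have [//|Fn] := in_ultra_setVsetC
  [set d | sat (rename p r) (sum_env e d)] F_ultra.
by have /= /(_ px) := Px (form_not (rename p r)) Fn.
Qed.

Lemma separation (B : set U) : small B -> A `<=` B ->
  exists p, C `&` tuples B `<=` solutions p /\ solutions p `<=` C.
Proof.
move=> B_small AB; apply: contrapT => no_sep.
pose D := C `&` tuples B.
(* Sets containing [D] minus a definable subset of [C]. The empty set is not among them, as [D]
   would then be covered by such a subset. *)
pose F0 := [set Y | exists2 p, solutions p `<=` C & D `\` solutions p `<=` Y].
have [] := @ultraFilterLemma _ F0.
  split.
    move=> [p pC pD]; apply: no_sep; exists p; split=> // c Dc.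
    by apply: contrapT => nc; apply: (pD c).
  split.
  - by exists (FBot L _) => // c [].
  - move=> Y Z [p pC pY] [q qC qZ].
    (* This is the disjunction of [p] and [q]; its solutions still lie in [C]. *)
    exists (FImp (form_not p) q).
      move=> c /= pq; have [|/pq/qC//] := pselect (solutions p c).
      exact: pC.
    move=> c [Dc nc]; split; [apply: pY|apply: qZ]; split=> // pc;
      apply: nc => /= np //.
    by case: np.
  - by move=> Y Z YZ [p pC pY]; exists p => // c /pY/YZ.
move=> F [F_ultra F0F].
have FD : F D by apply: F0F; exists (FBot L _) => // c [].
have FC : F C by apply: filterS FD => c [].
have FB : F (tuples B) by apply: filterS FD => c [].
have F_avoid p : solutions p `<=` C -> ~ F (solutions p).
  move=> pC Fp.
  have Fn : F (D `\` solutions p) by apply: F0F; exists p.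
  by have [c [pc [_ nc]]] := filter_ex (filterI Fp Fn).
(* Stated for every list, so that choice gives a function to iterate; the length of the list sets
   the parity. *)
have next_ex (s : seq ('I_m -> U)) :
    exists x, average F B (entries s) x /\ (C x <-> ~~ odd (size s)).
  apply: average_realized => //; apply: card_lt_setU => //.
  exact: small_entries.
have [next Hnext] := choice next_ex.
pose fix prefix n := if n is n'.+1 then next (prefix n') :: prefix n' else [::].
pose b n := next (prefix n).
have size_prefix n : size (prefix n) = n by elim: n => //= n ->.
have entries_prefix n : \bigcup_(i in `I_n) range (b i) `<=` entries (prefix n).
  elim: n => [|n IH] u [i /= ilt iu] //=.
  move: ilt iu; rewrite ltnS leq_eqVlt => /orP[/eqP->|ilt] iu; first by left.
  by right; apply: IH; exists i.
have [k Ck] := C_VC.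
have [|n|B0 B0k] := @alternation_shatters L U m U_sat U_inacc F A B C F_ultra
  FB AB B_small b _ _ k.
- move=> n; apply: (average_sub (@entries_prefix n)).
  exact: (Hnext (prefix n)).1.
- by have [_] := Hnext (prefix n); rewrite size_prefix.
- exact: Ck.
Qed.

Lemma approximable_below_of_finite_VC :
  card_lt [set: fun_symb L + rel_symb L] [set: U] -> approximable_below C.
Proof.
move=> L_lt; apply: contrapT => no_approx.
have /choice [Bad HBad] : forall np : {n : nat & form L ('I_n + 'I_m)},
    exists B : set U, finite_set B /\ ~ exists b : 'I_(tag np) -> U,
      instance (tagged np) b B = C `&` tuples B /\
      instance (tagged np) b setT `<=` C.
  move=> [n phi]; apply: contrapT => H; apply: no_approx.
  exists n, phi => B Bfin.
  by apply: contrapT => K; apply: H; exists B.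
have form_lt := card_lt_formulas m U_inacc L_lt.
have [f [f_inj _]] := inj_card_leT form_lt.1.
have [_ U_reg _] := U_inacc.
(* Regularity needs indices in [U], so formulas are indexed through the injection [f]; each inner
   union is a single set [Bad np]. *)
pose B := A `|` \bigcup_(u in range f) \bigcup_(np in f @^-1` [set u]) Bad np.
have [||p [Dp pC]] := @separation B.
- apply: card_lt_setU => //; apply: U_reg.
    exact: card_le_lt (card_image_le _ _) form_lt.
  move=> _ [np _ <-]; apply: finite_card_lt => //.
  apply: sub_finite_set (HBad np).1.
  by move=> x [np' /f_inj ->].
- by move=> x; left.
have [u0 _] := inaccessible_nonempty U_inacc.
have [W [p' [r Hr]]] := form_finite_support U p.
pose phi : form L ('I_#|W| + 'I_m) := rename p' (fun w =>
  match r w with inl _ => inl (enum_rank w) | inr j => inr j end).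
(* Parameters of [p] become the tuple [b]; the default [u0] fills the positions of names for
   coordinates of [c], which [phi] does not read from [b]. *)
pose b (i : 'I_#|W|) : U := if r (enum_val i) is inl u then u else u0.
have phiE c : sat phi (pair_env b c) <-> solutions p c.
  rewrite /phi sat_rename /solutions /= Hr.
  rewrite (_ : pair_env b c \o _ = sum_env id c \o r)//.
  apply/funext => w /=; case E: (r w) => [u|j] //=.
  by rewrite /b enum_rankK E.
pose np : {n & form L ('I_n + 'I_m)} := Tagged _ phi.
(* The finite set on which [phi] should fail is part of [B], where [p] agrees with [C]. *)
have [_] := HBad np; apply; exists b => /=; split; last first.
  by move=> c [_ /phiE/pC].
apply/seteqP; split=> c.
  by move=> [Bc /phiE/pC].
move=> [Cc Bc]; split=> //; apply/phiE/Dp; split=> // i; right.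
by exists (f np) => //; exists np => //; apply: Bc.
Qed.

End Approximation.

(** * Passing to the complement *)

Lemma realizes_tuple_types_setC (L : signature) (U : structure L) (m : nat)
    (C : set ('I_m -> U)) :
  realizes_tuple_types C -> realizes_tuple_types (~` C).
Proof.
have CE (b : bool) c : (~` C) c <-> b <-> (C c <-> ~~ b).
  have Eb : (~~ b : Prop) <-> ~ b by split; move/negP.
  by rewrite Eb /setC /=; have := EM (C c); have := EM b; tauto.
move=> C_types b V e P e_small P_fin.
have [s Ps|c [Pc Cc]] := C_types (~~ b) V e P e_small.
  by have [c [sc /CE Cc]] := P_fin s Ps; exists c.
by exists c; split=> //; apply/CE.
Qed.

(** The complement of the image of [C] is the image of its complement, so cutting out [H] with one
    orbit amounts to cutting out the rest of [B] with the other. *)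
Lemma finite_VC_setC (L : signature) (U : structure L) (m : nat)
    (C : set ('I_m -> U)) (A : set U) :
  finite_VC (aut_orbit C A) -> finite_VC (aut_orbit (~` C) A).
Proof.
move=> [k Ck]; exists k => B /Ck nsh sh; apply: nsh => H HB.
have [|E [f f_aut EC] HE] := sh (B `\` H); first by move=> c [].
have [[[g fK gK] _ _] _] := f_aut.
exists (~` E); last first.
  apply/seteqP; split=> c.
    move=> Hc; split; first exact: HB.
    move=> Ec; have : (B `\` H) c by rewrite HE; split => //; apply: HB.
    by case.
  move=> [Bc nE]; apply: contrapT => nH; apply: nE.
  by have : (B `\` H) c by []; rewrite HE => -[].
exists f => //; rewrite EC; apply/seteqP; split=> c.
  move=> nc; exists (g \o c); last by apply/funext => i /=; rewrite gK.
  apply: contrapT => nC; apply: nc; exists (g \o c) => //.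
  by apply/funext => i /=; rewrite gK.
move=> [d Cd <-] [d' nCd' dd']; apply: nCd'.
suff -> : d' = d by [].
by apply/funext => i; apply: (can_inj fK); have := congr1 (@^~ i) dd'.
Qed.

Theorem theorem3p5 (L : signature) (U : structure L)
  (U_saturated : saturated U)
  (U_inaccessible : inaccessible U)
  (L_lt_U : card_lt [set: fun_symb L + rel_symb L] [set: U])
  (m : nat) (C : set ('I_m -> U))
  (C_saturated : saturated_set C)
  (C_orbit : exists2 A : set U, small A & finite_VC (aut_orbit C A)) :
  approximable_below C /\ approximable_above C.
Proof.
have [A A_small C_VC] := C_orbit.
have C_types := saturated_set_tuple_types U_inaccessible C_saturated.
split; first exact: approximable_below_of_finite_VC A_small C_types C_VC _.
have [n [phi Hphi]] := approximable_below_of_finite_VC U_saturated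
  U_inaccessible A_small (realizes_tuple_types_setC C_types)
  (finite_VC_setC C_VC) L_lt_U.
(* Negation turns an approximation of the complement from below into one of [C] from above, with the
   same [b]. *)
exists n, (form_not phi) => B /Hphi [b [bB bC]]; exists b; split.
  have phiB c : tuples B c -> (sat phi (pair_env b c) <-> ~ C c).
    move=> Bc; have := congr1 (@^~ c) bB; rewrite /instance /setI /= => E.
    split=> [pc|nC]; first by have [] : (~ C c) /\ tuples B c by rewrite -E.
    by have [] : tuples B c /\ sat phi (pair_env b c) by rewrite E.
  apply/seteqP; split=> c [].
    move=> Bc npc; split=> //; apply: contrapT => nC.
    by apply: npc; apply/phiB.
  by move=> Cc Bc; split=> // /phiB; apply.
by move=> c Cc; split=> // pc; apply: (bC c).
Qed.
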